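(* There exist precisely seven nonzero $\mathcal{G}_{\mathcal{S}}$-invariant polynomials $Q$ of degree $\le4$ in the coordinates $x_1,\ldots,x_8$, namely those in the following table, which also displays their degrees, their (constant) values on the orbits $\mathcal{O}_1,\ldots,\mathcal{O}_5$, and their zero sets $\psi_Q=\{x\in\operatorname{PG}(7,2):Q(x)=0\}$: $$\begin{array}{c|c|ccccc|c|c} Q&\deg Q&\mathcal{O}_1&\mathcal{O}_2&\mathcal{O}_3&\mathcal{O}_4&\mathcal{O}_5&\psi_Q&|\psi_Q|\\ \hline Q_2&2&1&0&1&0&0&\mathcal{O}_2\cup\mathcal{O}_4\cup\mathcal{O}_5&135\\ Q_4&4&1&0&1&1&0&\mathcal{O}_2\cup\mathcal{O}_5&81\\ Q_4'&4&1&1&0&0&0&\mathcal{O}_3\cup\mathcal{O}_4\cup\mathcal{O}_5&189\\ Q_4+Q_4'&4&0&1&1&1&0&\mathcal{O}_1\cup\mathcal{O}_5&39\\ Q_2+Q_4&4&0&0&0&1&0&\mathcal{O}_1\cup\mathcal{O}_2\cup\mathcal{O}_3\cup\mathcal{O}_5&201\\ Q_2+Q_4'&4&0&1&1&0&0&\mathcal{O}_1\cup\mathcal{O}_4\cup\mathcal{O}_5&93\\ Q_2+Q_4+Q_4'&4&1&1&0&1&0&\mathcal{O}_3\cup\mathcal{O}_5&135 \end{array}$$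
   Context: Everything is over $\operatorname{GF}(2)$. Let $V_2$ be a 2-dimensional vector space over $\operatorname{GF}(2)$ with nonzero vectors $u_0,u_1,u_2$ (so $u_2=u_0+u_1$), and $V_8=V_2\otimes V_2\otimes V_2$. Points of $\operatorname{PG}(7,2)=\mathbb{P}V_8$ are identified with nonzero vectors of $V_8$. Put $E_{ijk}=u_i\otimes u_j\otimes u_k$ for $i,j,k\in\{0,1,2\}$. The Segre variety is the 27-point set $\mathcal{S}=\mathcal{S}_{1,1,1}(2)=\{E_{ijk}\}$; $\mathcal{G}_{\mathcal{S}}$ is its stabilizer in $\operatorname{GL}(V_8)$, equal to $\mathcal{N}\rtimes\operatorname{Sym}(3)$ where $\mathcal{N}=\operatorname{GL}(V_2)^3$ acts by maps $a_1\otimes a_2\otimes a_3$ and $\operatorname{Sym}(3)$ permutes the tensor factors. The point sets $\mathcal{O}_i$ (the $\mathcal{G}_{\mathcal{S}}$-orbits of points) are: $\mathcal{O}_5=\mathcal{S}$; $\mathcal{O}_2$ is the set of points outside $\mathcal{S}$ lying in one of the nine 3-flats spanned by the 9-point subsets of $\mathcal{S}$ obtained by fixing one of the three indices of $E_{ijk}$; $\mathcal{O}_4$ is the set of points outside $\mathcal{S}$ lying on some distinguished tangent $L(p)$, $p\in\mathcal{S}$, where $L(p)=\{p,p',p''\}$ and $p',p''$ are the two points of the 3-flat spanned by the three generators through $p$ that lie in none of the three planes spanned by two of these generators (generators are the lines in $\mathcal{S}$ obtained by fixing two indices of $E_{ijk}$ and letting the third vary); $\mathcal{O}_3$ is the set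 of points $E_{ijk}+E_{i'j'k'}$ with $i\ne i'$, $j\ne j'$, $k\ne k'$; and $\mathcal{O}_1$ is the set of all remaining points. Coordinates $x_1,\dots,x_8$ are with respect to the basis $e_1=E_{000}$, $e_2=E_{100}$, $e_3=E_{110}$, $e_4=E_{010}$, $e_5=E_{101}$, $e_6=E_{001}$, $e_7=E_{011}$, $e_8=E_{111}$. Polynomials are taken with zero constant term and in reduced form, i.e. as sums of squarefree monomials $x_{i_1}\cdots x_{i_k}$, $k\ge1$, $i_1<\cdots<i_k$; degree means degree of the reduced form. $Q$ is $\mathcal{G}_{\mathcal{S}}$-invariant if $Q(Ax)=Q(x)$ for all $A\in\mathcal{G}_{\mathcal{S}}$, $x\in V_8$. Writing $ij$, $ijk$, $ijkl$ for the monomials $x_ix_j$, $x_ix_jx_k$, $x_ix_jx_kx_l$, put $P_2'=13+15+17+35+37+57+24+26+28+46+48+68$; $P_2''=18+27+36+45$; $P_3'=135+137+157+357+246+248+268+468$; $P_3''=\sum_{i\ne1,8}x_1x_8x_i+\sum_{i\ne2,7}x_2x_7x_i+\sum_{i\ne3,6}x_3x_6x_i+\sum_{i\ne4,5}x_4x_5x_i$ (with $i\in\{1,\dots,8\}$); $P_4'=1278+1368+1458+2367+2457+3456$; $P_4'''=1357+2468$; $P_4^{\mathrm{v}}=1248+1268+1468+1358+1378+1578+1237+1257+2357+2467+2478+2678+2346+2368+3468+1356+1367+3567+1345+1457+3457+2456+2458+4568$. Then $Q_2=P_2''$, $Q_4=P_2''+P_3'+P_4'''+P_4^{\mathrm{v}}$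 and $Q_4'=P_2'+P_3'+P_3''+P_4'$. *)

(* Defs.v *)
From HB Require Import structures.
From mathcomp Require Import all_boot all_order all_algebra all_fingroup.
From mathcomp Require Import mxtens mpoly.

Set Implicit Arguments.
Unset Strict Implicit.
Unset Printing Implicit Defensive.

Import GRing.Theory.
Local Open Scope ring_scope.

Notation V2 := 'rV['F_2]_2.
Notation V8 := 'rV['F_2]_(2 * 2 * 2).

(* Over GF(2) a projective point is a nonzero vector. *)
Definition PG72 : {set V8} := [set x | x != 0].

Definition spanset (A : {set V8}) : {vspace V8} := <<enum A>>%VS.

Section Segre.

(* Intended for u injective and nowhere zero, so that u 0, u 1, u 2 are the
   three nonzero vectors of V2 in an arbitrary order. *)
Variable u : 'I_3 -> V2.

Definition E (i j k : 'I_3) : V8 := u i *t u j *t u k.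

(* A triple of indices is encoded as a map from the three tensor positions. *)
Definition Et (t : {ffun 'I_3 -> 'I_3}) : V8 := E (t 0) (t 1) (t 2).

Definition segre : {set V8} := [set Et t | t in setT].

(* Matrices act on row vectors on the right. *)
Definition segre_stab : {set {'GL_(2 * 2 * 2)['F_2]}} :=
  [set A : {'GL_(2 * 2 * 2)['F_2]} | [set (x : V8) *m GLval A | x in segre] == segre].

Definition face_flat (c k : 'I_3) : {vspace V8} :=
  spanset [set Et t | t in [set t : {ffun 'I_3 -> 'I_3} | t c == k]].

Definition generator (c : 'I_3) (t : {ffun 'I_3 -> 'I_3}) : {set V8} :=
  [set Et s | s in [set s : {ffun 'I_3 -> 'I_3} |
                     [forall d, (d != c) ==> (s d == t d)]]].

Definition generators_at (p : V8) : {set {set V8}} :=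
  [set g in [set generator c t | c in setT, t in setT] | p \in g].

Definition distinguished_tangent (p : V8) : {set V8} :=
  p |: [set x in PG72 | (x \in spanset (cover (generators_at p))) &&
         [forall g in generators_at p, forall h in generators_at p,
            (g != h) ==> (x \notin spanset (g :|: h))]].

Definition O5 : {set V8} := segre.

Definition O2 : {set V8} :=
  [set x in PG72 | (x \notin segre) &&
                   [exists c, exists k, x \in face_flat c k]].

Definition O4 : {set V8} :=
  [set x in PG72 | (x \notin segre) &&
                   [exists p in segre, x \in distinguished_tangent p]].

Definition O3 : {set V8} :=
  [set x | [exists t : {ffun 'I_3 -> 'I_3}, exists s : {ffun 'I_3 -> 'I_3},
              [forall c, t c != s c] && (x == Et t + Et s)]].

Definition O1 : {set V8} := PG72 :\: (O2 :|: O3 :|: O4 :|: O5).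

Definition ebasis : 8.-tuple V8 :=
  [tuple E 0 0 0; E 1 0 0; E 1 1 0; E 0 1 0; E 1 0 1; E 0 0 1; E 0 1 1; E 1 1 1].

Definition evalQ (Q : {mpoly 'F_2[8]}) (x : V8) : 'F_2 :=
  Q.@[fun i => coord ebasis i x].

Definition stab_invariant (Q : {mpoly 'F_2[8]}) : Prop :=
  forall A, A \in segre_stab -> forall x : V8,
    evalQ Q (x *m GLval A) = evalQ Q x.

Definition zero_set (Q : {mpoly 'F_2[8]}) : {set V8} :=
  [set x in PG72 | evalQ Q x == 0].

End Segre.

(* Squarefree monomials only, and no constant term. *)
Definition reduced (Q : {mpoly 'F_2[8]}) : bool :=
  all (fun m : 'X_{1..8} => (m != 0%MM) && [forall i, (m i <= 1)%N]) (msupp Q).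

(* msize is one more than the total degree; only used for nonzero Q. *)
Definition deg (Q : {mpoly 'F_2[8]}) : nat := (msize Q).-1.

(* mon [:: i; j; ...] is x_i x_j ..., with variables numbered from 1 to 8. *)
Definition mon (s : seq nat) : {mpoly 'F_2[8]} :=
  \prod_(i <- s) 'X_(inord i.-1).

Definition monsum (l : seq (seq nat)) : {mpoly 'F_2[8]} := \sum_(s <- l) mon s.

Definition P2' := monsum
  [:: [:: 1; 3]; [:: 1; 5]; [:: 1; 7]; [:: 3; 5]; [:: 3; 7]; [:: 5; 7];
      [:: 2; 4]; [:: 2; 6]; [:: 2; 8]; [:: 4; 6]; [:: 4; 8]; [:: 6; 8]]%N.

Definition P2'' := monsum [:: [:: 1; 8]; [:: 2; 7]; [:: 3; 6]; [:: 4; 5]]%N.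

Definition P3' := monsum
  [:: [:: 1; 3; 5]; [:: 1; 3; 7]; [:: 1; 5; 7]; [:: 3; 5; 7];
      [:: 2; 4; 6]; [:: 2; 4; 8]; [:: 2; 6; 8]; [:: 4; 6; 8]]%N.

Definition P3'' : {mpoly 'F_2[8]} :=
    \sum_(1 <= i < 9 | i \notin [:: 1; 8]%N) mon [:: 1; 8; i]%N
  + \sum_(1 <= i < 9 | i \notin [:: 2; 7]%N) mon [:: 2; 7; i]%N
  + \sum_(1 <= i < 9 | i \notin [:: 3; 6]%N) mon [:: 3; 6; i]%N
  + \sum_(1 <= i < 9 | i \notin [:: 4; 5]%N) mon [:: 4; 5; i]%N.

Definition P4' := monsum
  [:: [:: 1; 2; 7; 8]; [:: 1; 3; 6; 8]; [:: 1; 4; 5; 8];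
      [:: 2; 3; 6; 7]; [:: 2; 4; 5; 7]; [:: 3; 4; 5; 6]]%N.

Definition P4''' := monsum [:: [:: 1; 3; 5; 7]; [:: 2; 4; 6; 8]]%N.

Definition P4v := monsum
  [:: [:: 1; 2; 4; 8]; [:: 1; 2; 6; 8]; [:: 1; 4; 6; 8]; [:: 1; 3; 5; 8];
      [:: 1; 3; 7; 8]; [:: 1; 5; 7; 8]; [:: 1; 2; 3; 7]; [:: 1; 2; 5; 7];
      [:: 2; 3; 5; 7]; [:: 2; 4; 6; 7]; [:: 2; 4; 7; 8]; [:: 2; 6; 7; 8];
      [:: 2; 3; 4; 6]; [:: 2; 3; 6; 8]; [:: 3; 4; 6; 8]; [:: 1; 3; 5; 6];
      [:: 1; 3; 6; 7]; [:: 3; 5; 6; 7]; [:: 1; 3; 4; 5]; [:: 1; 4; 5; 7];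
      [:: 3; 4; 5; 7]; [:: 2; 4; 5; 6]; [:: 2; 4; 5; 8]; [:: 4; 5; 6; 8]]%N.

Definition Q2 : {mpoly 'F_2[8]} := P2''.
Definition Q4 : {mpoly 'F_2[8]} := P2'' + P3' + P4''' + P4v.
Definition Q4' : {mpoly 'F_2[8]} := P2' + P3' + P3'' + P4'.

Definition values_on_orbits (u : 'I_3 -> V2) (Q : {mpoly 'F_2[8]})
    (v1 v2 v3 v4 v5 : 'F_2) : Prop :=
  [/\ forall x, x \in O1 u -> evalQ u Q x = v1,
      forall x, x \in O2 u -> evalQ u Q x = v2,
      forall x, x \in O3 u -> evalQ u Q x = v3,
      forall x, x \in O4 u -> evalQ u Q x = v4
    & forall x, x \in O5 u -> evalQ u Q x = v5].

(* Main.v *)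
Require Import Defs.
From HB Require Import structures.
From mathcomp Require Import all_boot all_order all_algebra all_fingroup.
From mathcomp Require Import mxtens mpoly.
From mathcomp Require Import ring.

(** Coordinates with respect to [ebasis u] turn vectors of V8 into words of
eight bits, and in these coordinates nothing depends on [u] any more: the
coordinates of E_ijk are products of the coordinates of u_i, u_j, u_k
([E_word]).  The theorem thus speaks about functions on 256 words, and three
ideas make it a finite computation.

First, the stabilizer of the Segre variety S is large enough.  Four involutions
(two transpositions of the values of the first index, two transpositions of
tensor factors) preserve S, and starting from six representatives they reach
every word.  The six sets of words found in this way are the zero vector and
O_1, ..., O_5 ([mem_orbits]), so that an invariant function is determined by
its values at the representatives ([invariant_rep]).

Second, the stabilizer is not larger than that.  The number of pairs (p, q) in
S x S with x + p + q in S does not change when a linear map that preserves S is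
applied to x.  It takes the values 162, 18, 78, 72, 60, 151 on 0, O_1, ..., O_5;
as these are distinct, every element of the stabilizer maps each O_i to itself
([orbit_index_stab]).  Hence every polynomial whose value depends only on the
index i is invariant.

Third, a reduced polynomial is governed by its values through Moebius inversion
on subsets: over GF(2) the coefficient of the product of the x_i, i in T, is the
sum of the values at all words supported in T ([mcoeff_sum_below]).  So
reduced polynomials with the same values are equal, and degree at most 4 means
that these sums vanish whenever T has at least five elements.  Let c_i be the
value of an invariant polynomial on O_i.  The empty T gives the value 0 at the
zero vector, T = {1,2,3,4,5} gives c_5 = 0 and T = {1,2,3,5,7} gives
c_1 + c_2 + c_3 = 0.  This leaves eight functions, the span of Q_2, Q_4 and Q_4',
whose values are checked word by word.  The same sums, taken over the support of
one monomial of top degree, show that the degrees are not smaller than stated. *)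

Set Implicit Arguments.
Unset Strict Implicit.
Unset Printing Implicit Defensive.

Import GRing.Theory.
Local Open Scope ring_scope.

(** * Arithmetic of GF(2) and words of bits *)

Lemma F2_natr (x : 'F_2) : x = (x == 1)%:R.
Proof. by case: x => [[|[|]]] // ?; apply: val_inj. Qed.

Lemma F2_natr_eq1 (b : bool) : (b%:R == 1 :> 'F_2) = b.
Proof. by case: b. Qed.

Lemma F2_natr_addb (a b : bool) : (a (+) b)%:R = a%:R + b%:R :> 'F_2.
Proof. by case: a; case: b => //=; apply: val_inj. Qed.

Lemma F2_natr_andb (a b : bool) : (a && b)%:R = a%:R * b%:R :> 'F_2.
Proof. by case: a; case: b => //=; apply: val_inj. Qed.

Lemma F2_addrr (V : lmodType 'F_2) (x : V) : x + x = 0.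
Proof.
by rewrite -{1 2}[x]scale1r -scalerDl (_ : 1 + 1 = 0 :> 'F_2) ?scale0r //; apply: val_inj.
Qed.

(** The longer word is kept beyond the end of the shorter one, so that [nth_xor]
needs no hypothesis on sizes. *)
Fixpoint xor (w v : seq bool) : seq bool :=
  match w, v with
  | a :: w', b :: v' => (a (+) b) :: xor w' v'
  | [::], _ => v
  | _, [::] => w
  end.

Lemma nth_xor w v i : nth false (xor w v) i = nth false w i (+) nth false v i.
Proof.
by elim: w v i => [|a w IHw] [|b v] [|i] //=; rewrite ?nth_nil ?addbF.
Qed.

Lemma size_xor w v : size (xor w v) = maxn (size w) (size v).
Proof.
elim: w v => [|a w IHw] [|b v] //=; rewrite ?max0n ?maxn0 //.
by rewrite IHw maxnSS.
Qed.

Lemma xorK w v : size w = size v -> xor (xor w v) v = w.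
Proof.
move=> wv; apply: (@eq_from_nth _ false) => [|i _]; first by rewrite !size_xor wv !maxnn.
by rewrite !nth_xor addbK.
Qed.

Fixpoint words n : seq (seq bool) :=
  if n is n'.+1 then [seq b :: w | b <- [:: true; false], w <- words n']
  else [:: [::]].

Lemma mem_words n w : (w \in words n) = (size w == n).
Proof.
elim: n w => [|n IHn] w; first by rewrite inE; case: w.
apply/allpairsP/idP => [[[b v] /= [_ v_n ->]]|].
  by rewrite /= eqSS -IHn.
case: w => // b w /=; rewrite eqSS -IHn => w_n.
by exists (b, w); split => //; case: b.
Qed.

Lemma uniq_words n : uniq (words n).
Proof.
elim: n => //= n IHn; apply: (allpairs_uniq (s := [:: true; false])) => //.
by move=> [a v] [b w] _ _ /= [-> ->].
Qed.

(** * Moebius inversion for squarefree polynomials *)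

(** The words that are bitwise at most [T]: the indicator words of the subsets
of the set with indicator word [T]. *)
Fixpoint below (T : seq bool) : seq (seq bool) :=
  if T is b :: T' then
    [seq a :: w | a <- (if b then [:: true; false] else [:: false]), w <- below T']
  else [:: [::]].

Lemma size_below T : {in below T, forall w, size w = size T}.
Proof.
by elim: T => [w|b T IHT _ /allpairsP[[a w] /= [_ /IHT <- ->]] //]; rewrite inE => /eqP->.
Qed.

Definition bits n (w : seq bool) (i : 'I_n) : 'F_2 := (nth false w i)%:R.

Definition squarefree_mnm n (w : seq bool) : 'X_{1..n} := [multinom (nth false w i : nat) | i < n].

(** The sum over the subsets of T of a product of functions of the single bits
factors over the bits.  The factor at i is 1 + [m_i = 0] if i is in T and
[m_i = 0] otherwise; in characteristic 2 both equal [m_i = T_i]. *)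
Lemma sum_below_monomial (T : seq bool) (m : nat -> nat) :
    (forall i, m i <= 1)%N ->
  \sum_(w <- below T) \prod_(i < size T) (bits w i ^+ m i)
    = \prod_(i < size T) (m i == nth false T i)%:R :> 'F_2.
Proof.
elim: T m => [|b T IHT] m m_le1; first by rewrite big_seq1 !big_ord0.
have IH := IHT (fun i => m i.+1) (fun i => m_le1 i.+1).
have split0 (a : bool) : \sum_(w <- below T) \prod_(i < (size T).+1) (bits (a :: w) i ^+ m i)
     = a%:R ^+ m 0 * \prod_(i < size T) (m i.+1 == nth false T i)%:R.
  rewrite -IH mulr_sumr; apply: eq_bigr => w _.
  by rewrite big_ord_recl; congr (_ * _); apply: eq_bigr.
rewrite big_ord_recl /= -/(below T) big_allpairs_dep /=.
case: b; rewrite /= ?big_cons big_nil addr0 !split0 -?mulrDl.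
  congr (_ * _); rewrite expr1n.
  by case: (m 0) (m_le1 0) => [|[|]] // _; apply: val_inj.
by congr (_ * _); case: (m 0) (m_le1 0) => [|[|]] // _; apply: val_inj.
Qed.

Definition squarefree n (Q : {mpoly 'F_2[n]}) :=
  forall m, m \in msupp Q -> forall i, (m i <= 1)%N.

(** Moebius inversion over GF(2), where all signs disappear: by
[sum_below_monomial] only the monomial with support T survives the summation. *)
Lemma mcoeff_sum_below n (Q : {mpoly 'F_2[n]}) (T : seq bool) :
    squarefree Q -> size T = n ->
  Q@_(squarefree_mnm n T) = \sum_(w <- below T) Q.@[bits w].
Proof.
move=> Qsf Tn; under eq_bigr do rewrite mevalE.
rewrite exchange_big /= -[LHS]mulr1.
transitivity (\sum_(m <- msupp Q) Q@_m * (m == squarefree_mnm n T)%:R).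
  case: (boolP (squarefree_mnm n T \in msupp Q)) => [T_Q|/memN_msupp_eq0 T_Q].
    rewrite (bigD1_seq _ T_Q) ?msupp_uniq //= eqxx big1 ?addr0 // => m /negPf->.
    by rewrite mulr0.
  rewrite T_Q mul0r big1_seq // => m /= _.
  by case: eqP => [->|_]; rewrite ?T_Q ?mul0r ?mulr0.
rewrite !big_seq; apply: eq_bigr => m m_Q; rewrite -mulr_sumr; congr (_ * _).
(* [sum_below_monomial] takes exponents indexed by nat: they are continued by 0. *)
pose m' i := oapp (fun i : 'I_n => m i) 0 (insub i).
have m'E (i : 'I_n) : m' i = m i by rewrite /m' valK.
have m'_le1 i : (m' i <= 1)%N by rewrite /m'; case: insubP => //= j _ _; apply: Qsf.
have := sum_below_monomial T m'_le1; rewrite Tn.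
under eq_bigr do under eq_bigr do rewrite m'E.
move=> ->; case: (m =P _) => [m_T|m_neT].
  by rewrite big1 // => i _; rewrite m'E m_T mnmE eqxx.
apply/esym/eqP/prodf_eq0.
have /existsP[i m_i] : [exists i, m i != nth false T i].
  apply: contraT; rewrite negb_exists => /forallP eq_mT; case: m_neT.
  by apply/mnmP => i; rewrite mnmE; apply/eqP; rewrite -[_ == _]negbK eq_mT.
by exists i => //; rewrite m'E (negPf m_i).
Qed.

Lemma mdeg_squarefree_mnm (T : seq bool) :
  mdeg (squarefree_mnm (size T) T) = count id T.
Proof.
rewrite mdegE -sum1_count (big_nth false) big_mkord [RHS]big_mkcond /=.
by apply: eq_bigr => i _; rewrite mnmE; case: nth.
Qed.

(** Every coefficient is a sum of values. *)
Lemma squarefree_eq0 n (Q : {mpoly 'F_2[n]}) : squarefree Q ->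
  (forall w, size w = n -> Q.@[bits w] = 0) -> Q = 0.
Proof.
move=> Qsf Q0; apply/mpolyP => m; rewrite mcoeff0.
case: (boolP (m \in msupp Q)) => [m_Q|/memN_msupp_eq0->//].
pose T := mkseq (fun i => oapp (fun i : 'I_n => m i == 1) false (insub i)) n.
have Tn : size T = n by rewrite size_mkseq.
have -> : m = squarefree_mnm n T.
  apply/mnmP => i; rewrite mnmE nth_mkseq // valK /=.
  by case: (m i) (Qsf m m_Q i) => [|[|]].
rewrite mcoeff_sum_below // big1_seq // => w /andP[_ w_T]; apply: Q0.
rewrite -Tn; elim: (T) w w_T => [|b T' IHT] w; first by rewrite inE => /eqP->.
by case/allpairsP => -[a v] /= [_ /IHT v_T ->] /=; rewrite v_T.
Qed.

(** * The configuration in coordinates *)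

Definition zero_word : seq bool := nseq 8 false.

(** Adding a vector v to a spanning family leaves a subspace s unchanged if v is
in s, and otherwise adds the coset s + v. *)
Fixpoint span_words (l : seq (seq bool)) : seq (seq bool) :=
  if l is v :: l' then
    let s := span_words l' in if v \in s then s else s ++ [seq xor w v | w <- s]
  else [:: zero_word].

Lemma size_span_words l : all (fun w => size w == 8%N) l ->
  {in span_words l, forall w, size w = 8%N}.
Proof.
elim: l => [_ w|v l IHl /= /andP[/eqP v8 /IHl{}IHl]]; first by rewrite inE => /eqP->.
case: ifP => // _ w; rewrite mem_cat => /orP[/IHl //|/mapP[{}w /IHl w8 ->]].
by rewrite size_xor w8 v8.
Qed.

Definition basis_triples : seq (seq nat) :=
  [:: [:: 0; 0; 0]; [:: 1; 0; 0]; [:: 1; 1; 0]; [:: 0; 1; 0];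
      [:: 1; 0; 1]; [:: 0; 0; 1]; [:: 0; 1; 1]; [:: 1; 1; 1]]%N.

(** The coordinate of u_i along u_a, for a = 0, 1; it relies on u_2 = u_0 + u_1. *)
Definition ubit (i a : nat) : bool := (i == a) || (i == 2%N).

Definition segre_word (t : seq nat) : seq bool :=
  [seq all (fun c => ubit (nth 0%N t c) (nth 0%N s c)) (iota 0 3)
  | s <- basis_triples].

Lemma size_segre_word t : size (segre_word t) = 8%N.
Proof. exact: size_map. Qed.

(** A triple of indices is a list of three numbers below 3, and a word has the
coordinates in the order of [basis_triples]. *)
Definition triples : seq (seq nat) :=
  [seq i :: s | i <- iota 0 3, s <- [seq [:: j; k] | j <- iota 0 3, k <- iota 0 3]].

Definition segre_words : seq (seq bool) := map segre_word triples.

Lemma segre_word_inj : {in triples &, injective segre_word}.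
Proof.
have /allP inj_check : all (fun s => all (fun t =>
    (segre_word s == segre_word t) ==> (s == t)) triples) triples by vm_compute.
move=> s t /inj_check/allP s_inj /s_inj/implyP st_inj st.
by apply/eqP/st_inj/eqP.
Qed.

Definition face_words c k := [seq segre_word t | t <- triples & nth 0 t c == k]%N.

Definition generator_words c t :=
  [seq segre_word s | s <- triples &
    all (fun d => (d != c) ==> (nth 0 s d == nth 0 t d)%N) (iota 0 3)].

Lemma size_image_words p :
  all (fun w => size w == 8%N) [seq segre_word t | t <- triples & p t].
Proof. by apply/allP => _ /mapP[t _ ->]; rewrite size_segre_word. Qed.

Definition face_flat_words :=
  [seq span_words (face_words c k) | c <- iota 0 3, k <- iota 0 3].

Definition tangent_words t :=
  segre_word t ::
  [seq w <- span_words (flatten [seq generator_words c t | c <- iota 0 3]) |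
    (w != zero_word) && all (fun c => all (fun d => (c != d) ==>
      (w \notin span_words (generator_words c t ++ generator_words d t)))
      (iota 0 3)) (iota 0 3)].

Definition all_tangent_words := [seq tangent_words t | t <- triples].

Definition O2_word w :=
  [&& w != zero_word, w \notin segre_words & has (fun l => w \in l) face_flat_words].

Definition O3_words :=
  [seq xor (segre_word p.1) (segre_word p.2)
  | p <- [seq (t, s) | t <- triples, s <- triples]
  & all (fun c => nth 0 p.1 c != nth 0 p.2 c)%N (iota 0 3)].

Definition O4_word w :=
  [&& w != zero_word, w \notin segre_words & has (fun l => w \in l) all_tangent_words].

(** * Orbits of words *)

(** The linear map that sends the i-th basis vector to the i-th word of [M]. *)
Definition act_word (M : seq (seq bool)) (w : seq bool) : seq bool :=
  foldr (fun i => xor (if nth false w i then nth [::] M i else [::]))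
    zero_word (iota 0 8).

(** Transpositions of the values 0, 1 and of the values 1, 2 of the first index,
and of two adjacent tensor factors; they generate Sym(3) wr Sym(3). *)
Definition index_moves : seq (seq nat -> seq nat) :=
  [:: fun t => [:: nth 0 [:: 1; 0; 2] (nth 0 t 0); nth 0 t 1; nth 0 t 2];
      fun t => [:: nth 0 [:: 0; 2; 1] (nth 0 t 0); nth 0 t 1; nth 0 t 2];
      fun t => [:: nth 0 t 1; nth 0 t 0; nth 0 t 2];
      fun t => [:: nth 0 t 0; nth 0 t 2; nth 0 t 1]]%N.

Definition moves := [seq [seq segre_word (f t) | t <- basis_triples] | f <- index_moves].

(** Depth-first search; the fuel [n] bounds the length of a path, and 256 suffices
as a path does not visit a word twice. *)
Fixpoint reach n (seen : seq (seq bool)) w :=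
  if n is n'.+1 then
    if w \in seen then seen else
    foldl (reach n') (w :: seen) [seq act_word M w | M <- moves]
  else seen.

(** Used for the property that an invariant function has the value that it has at
the start of the search. *)
Lemma all_reach (P : pred (seq bool)) n seen w :
    (forall M v, M \in moves -> P v -> P (act_word M v)) ->
  all P seen -> P w -> all P (reach n seen w).
Proof.
move=> P_act; elim: n seen w => [//|n IHn] seen w P_seen P_w.
rewrite /reach -/reach; case: ifP => // _.
have : all P [seq act_word M w | M <- moves].
  by rewrite all_map; apply/allP => M M_in; apply: P_act.
have : all P (w :: seen) by rewrite /= P_w.
elim: (map _ _) (w :: seen) => //= v l IHl s P_s /andP[P_v P_l].
by apply: IHl; rewrite ?IHn.
Qed.

(** One representative of {0}, O_1, ..., O_5, in this order.  A point of O_1 is the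
sum of three points of S any two of which differ in all indices, and the given
point of O_4 lies on the tangent at E_000. *)
Definition orbit_reps : seq (seq bool) :=
  let e i j k := segre_word [:: i; j; k]%N in
  [:: zero_word;
      xor (e 0 0 0) (xor (e 1 1 1) (e 2 2 2));
      xor (e 0 0 0) (e 0 1 1);
      xor (e 0 0 0) (e 1 1 1);
      xor (e 0 0 1) (xor (e 0 1 0) (e 1 0 0));
      e 0 0 0]%N.

Definition orbits := [seq reach 256 [::] r | r <- orbit_reps].

Definition orbit_index w := find (fun l => w \in l) orbits.

Arguments orbit_index : simpl never.

(** Since every index is below 6, the words of index 1 are those in none of the
other sets, which is how O_1 is defined. *)
Lemma orbit_check : all (fun w =>
  let i := orbit_index w in
  [&& i < 6, (i == 0) == (w == zero_word), (i == 2) == O2_word w,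
      (i == 3) == (w \in O3_words), (i == 4) == O4_word w
    & (i == 5) == (w \in segre_words)]%N) (words 8).
Proof. by vm_compute. Qed.

Lemma moves_check : all (fun M =>
    all (fun w => act_word M (act_word M w) == w) (words 8) &&
    all (fun w => act_word M w \in segre_words) segre_words) moves.
Proof. by vm_compute. Qed.

Definition triple_count w : nat :=
  sumn [seq sumn [seq (xor (xor w p) q \in segre_words) : nat | q <- segre_words]
       | p <- segre_words].

(** The counts are 162, 18, 78, 72, 60, 151. *)
Lemma triple_count_check :
  uniq (map triple_count orbit_reps) && all (fun w => size w == 8%N) orbit_reps.
Proof. by vm_compute. Qed.

(** * Values and coefficients of the seven polynomials *)

Lemma reduced_squarefree Q : reduced Q -> squarefree Q /\ Q@_0%MM = 0.
Proof.
move=> /allP Q_red; split=> [m /Q_red/andP[_ /forallP] //|].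
by apply: memN_msupp_eq0; apply/negP => /Q_red; rewrite eqxx.
Qed.

Lemma reducedD P Q : reduced P -> reduced Q -> reduced (P + Q).
Proof.
move=> /allP P_red /allP Q_red; apply/allP => m /msuppD_le.
by rewrite mem_cat => /orP[/P_red|/Q_red].
Qed.

Definition reduced_monomial (s : seq nat) : bool :=
  [&& s != [::], uniq s & all (fun i => 0 < i < 9)%N s].

Lemma mon_mnm (s : seq nat) : mon s = 'X_[\sum_(i <- s) U_(inord i.-1)].
Proof. exact: mprodXE. Qed.

Lemma mdeg_mon (s : seq nat) : mdeg (\sum_(i <- s) U_((inord i.-1 : 'I_8))) = size s.
Proof. by rewrite mdeg_sum (eq_bigr (fun=> 1%N)) => [|i _]; rewrite ?mdeg1 // sum1_size. Qed.

Lemma reduced_mon s : reduced_monomial s -> reduced (mon s).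
Proof.
case/and3P => s_nil s_uniq /allP s_vars; rewrite /reduced mon_mnm msuppX /= andbT.
rewrite -mdeg_eq0 mdeg_mon size_eq0 s_nil; apply/forallP => k.
have -> : (\sum_(i <- s) U_(inord i.-1))%MM k = count_mem k.+1 s.
  rewrite mnm_sumE -sum1_count [RHS]big_mkcond !big_seq; apply: eq_bigr => i /s_vars i_var.
  rewrite mnm1E -val_eqE /= inordK; last by case: i i_var.
  by case: i i_var => // i _; rewrite eqSS; case: eqP.
by rewrite count_uniq_mem // leq_b1.
Qed.

Lemma reduced_monsum l : all reduced_monomial l -> reduced (monsum l).
Proof.
elim: l => [_|s l IHl /= /andP[/reduced_mon s_red /IHl]].
  by rewrite /monsum big_nil /reduced msupp0.
by rewrite /monsum big_cons; apply: reducedD.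
Qed.

Lemma msize_monsum d l : all (fun s => size s <= d)%N l -> (msize (monsum l) <= d.+1)%N.
Proof.
elim: l => [_|s l IHl /= /andP[s_d /IHl l_d]]; first by rewrite /monsum big_nil msize0.
rewrite /monsum big_cons; apply: leq_trans (msizeD_le _ _) _; rewrite geq_max l_d andbT.
by rewrite mon_mnm msizeX ltnS mdeg_mon.
Qed.

Definition eval_monomials (l : seq (seq nat)) (w : seq bool) : bool :=
  foldr (fun s b => all (fun i => nth false w i.-1) s (+) b) false l.

Lemma meval_monsum l w : all reduced_monomial l ->
  (monsum l).@[bits w] = (eval_monomials l w)%:R.
Proof.
elim: l => [_|s l IHl /= /andP[/and3P[_ _ s_vars] /IHl l_w]].
  by rewrite /monsum big_nil meval0.
rewrite /monsum big_cons mevalD l_w F2_natr_addb; congr (_ + _).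
elim: s s_vars => [_|i s IHs /= /andP[i_var /IHs s_w]].
  by rewrite /mon big_nil meval1.
rewrite /mon big_cons mevalM mevalXU s_w F2_natr_andb /bits inordK //.
by case: i i_var.
Qed.

(** The values of [Q] depend only on the orbit; [v] lists them, beginning with the
value at the zero vector. *)
Definition has_values (Q : {mpoly 'F_2[8]}) (v : seq bool) : Prop :=
  forall w, size w = 8%N -> Q.@[bits w] = (nth false v (orbit_index w))%:R.

Lemma has_valuesD P Q v v' :
  has_values P v -> has_values Q v' -> has_values (P + Q) (xor v v').
Proof. by move=> Pv Qv w w8; rewrite mevalD Pv // Qv // nth_xor F2_natr_addb. Qed.

Definition tabulated Q v := [/\ reduced Q, (msize Q <= 5)%N & has_values Q v].

Lemma tabulatedD P Q v v' :
  tabulated P v -> tabulated Q v' -> tabulated (P + Q) (xor v v').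
Proof.
case=> P_red P_size Pv [Q_red Q_size Qv]; split; [exact: reducedD| |exact: has_valuesD].
by apply: leq_trans (msizeD_le _ _) _; rewrite geq_max P_size.
Qed.

(** It is enough to evaluate the polynomial at the 256 words. *)
Lemma tabulated_monsum l v :
    all reduced_monomial l -> all (fun s => size s <= 4)%N l ->
    all (fun w => eval_monomials l w == nth false v (orbit_index w)) (words 8) ->
  tabulated (monsum l) v.
Proof.
move=> l_red l_size /allP l_v; split; [exact: reduced_monsum|exact: msize_monsum|].
by move=> w w8; rewrite meval_monsum // (eqP (l_v w _)) // mem_words w8.
Qed.

Lemma monsum_cat l l' : monsum (l ++ l') = monsum l + monsum l'.
Proof. exact: big_cat. Qed.

Lemma Q2_tabulated : tabulated Q2 [:: false; true; false; true; false; false].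
Proof. by apply: tabulated_monsum; vm_compute. Qed.

Lemma Q4_tabulated : tabulated Q4 [:: false; true; false; true; true; false].
Proof.
by rewrite /Q4 /P2'' /P3' /P4''' /P4v -!monsum_cat; apply: tabulated_monsum; vm_compute.
Qed.

Lemma Q4'_tabulated : tabulated Q4' [:: false; true; true; false; false; false].
Proof.
have filter_monsum (a b : nat) :
    \sum_(1 <= i < 9 | i \notin [:: a; b]) mon [:: a; b; i]
    = monsum [seq [:: a; b; i] | i <- index_iota 1 9 & i \notin [:: a; b]].
  by rewrite /monsum big_map big_filter.
rewrite /Q4' /P2' /P3' /P3'' /P4' !filter_monsum -!monsum_cat.
by apply: tabulated_monsum; vm_compute.
Qed.

(** The Moebius sum for a polynomial with values [v]. *)
Definition below_parity (T v : seq bool) : bool :=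
  foldr (fun w b => nth false v (orbit_index w) (+) b) false (below T).

Lemma mcoeff_below_parity Q v T : squarefree Q -> has_values Q v -> size T = 8%N ->
  Q@_(squarefree_mnm 8 T) = (below_parity T v)%:R.
Proof.
move=> Q_sf Qv T8; rewrite mcoeff_sum_below // /below_parity.
elim: below (@size_below T) => [|w s IHs] sT; first by rewrite big_nil.
rewrite big_cons F2_natr_addb -IHs => [|x x_s]; last by apply: sT; rewrite inE x_s orbT.
by rewrite Qv // sT ?mem_head.
Qed.

(** Their difference is squarefree and vanishes at every word. *)
Lemma has_values_inj P Q v : reduced P -> reduced Q ->
  has_values P v -> has_values Q v -> P = Q.
Proof.
move=> /reduced_squarefree[P_sf _] /reduced_squarefree[Q_sf _] Pv Qv.
apply/eqP; rewrite -subr_eq0; apply/eqP.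
apply: squarefree_eq0 => [m /msuppB_le|w w8]; last by rewrite mevalB Pv // Qv // subrr.
by rewrite mem_cat => /orP[/P_sf|/Q_sf].
Qed.

Definition invariants : seq {mpoly 'F_2[8]} :=
  [:: Q2; Q4; Q4'; Q4 + Q4'; Q2 + Q4; Q2 + Q4'; Q2 + Q4 + Q4'].

Definition invariant_values : seq (seq bool) :=
  let v2 := [:: false; true; false; true; false; false] in
  let v4 := [:: false; true; false; true; true; false] in
  let v4' := [:: false; true; true; false; false; false] in
  [:: v2; v4; v4'; xor v4 v4'; xor v2 v4; xor v2 v4'; xor (xor v2 v4) v4'].

Lemma invariants_tabulated i : (i < 7)%N ->
  tabulated (nth 0 invariants i) (nth [::] invariant_values i).
Proof.
move=> i_lt7; have q2 := Q2_tabulated; have q4 := Q4_tabulated.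
have q4' := Q4'_tabulated.
case: i i_lt7 => [|[|[|[|[|[|[|//]]]]]]] _.
- exact: q2.
- exact: q4.
- exact: q4'.
- exact: tabulatedD q4 q4'.
- exact: tabulatedD q2 q4.
- exact: tabulatedD q2 q4'.
exact: tabulatedD (tabulatedD q2 q4) q4'.
Qed.

Definition rep_values (Q : {mpoly 'F_2[8]}) : seq bool :=
  [seq Q.@[bits r] == 1 | r <- orbit_reps].

Lemma has_values_rep Q v : has_values Q v -> size v = 6%N -> rep_values Q = v.
Proof.
have reps_check : map orbit_index orbit_reps = iota 0 6 /\ all (fun r => size r == 8%N) orbit_reps.
  by split; vm_compute.
case: reps_check => reps_index /allP reps8 Qv v6.
rewrite -[RHS](mkseq_nth false v) v6 /mkseq -reps_index -map_comp.
apply/eq_in_map => r /reps8/eqP r8.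
by rewrite (Qv _ r8) F2_natr_eq1.
Qed.

Lemma map_rep_values_invariants : map rep_values invariants = invariant_values.
Proof.
apply: (@eq_from_nth _ [::]) => // i i_lt7; rewrite size_map in i_lt7.
rewrite (nth_map 0) //; have [_ _ Qv] := invariants_tabulated i_lt7.
apply: (has_values_rep Qv).
by case: i i_lt7 {Qv} => [|[|[|[|[|[|[|//]]]]]]].
Qed.

Lemma uniq_invariants : uniq invariants.
Proof. by apply: (map_uniq (f := rep_values)); rewrite map_rep_values_invariants. Qed.

Lemma invariants_neq0 Q : Q \in invariants -> Q != 0.
Proof.
apply: contraTneq => ->; apply/negP => /(map_f rep_values).
rewrite map_rep_values_invariants (@has_values_rep 0 (nseq 6 false)) //.
by move=> w _; rewrite meval0 nth_nseq if_same.
Qed.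

Definition support_word (s : seq nat) : seq bool := [seq i \in s | i <- iota 1 8].

Lemma size_support_word s : size (support_word s) = 8%N.
Proof. exact: size_map. Qed.

(** A lower bound for the degree comes from one monomial: its coefficient is the
Moebius sum over its support, which is odd. *)
Lemma deg_tabulated Q v s d : tabulated Q v -> (msize Q <= d.+1)%N ->
  below_parity (support_word s) v && (count id (support_word s) == d) -> deg Q = d.
Proof.
case=> /reduced_squarefree[Q_sf _] _ Qv Q_d /andP[s_odd /eqP s_d]; apply/eqP; rewrite eqn_leq.
have T8 := size_support_word s.
suff : (d < msize Q)%N by rewrite /deg; case: (msize Q) Q_d => // n; rewrite !ltnS => -> ->.
rewrite -s_d -mdeg_squarefree_mnm T8; apply: msize_mdeg_lt.
by rewrite mcoeff_msupp (mcoeff_below_parity Q_sf Qv T8) s_odd.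
Qed.

(** These are the linear conditions c_0 = 0, c_0 + c_5 = 0 and
c_0 + c_1 + c_2 + c_3 = 0 on the values of a polynomial; their solutions form
a space of dimension 3. *)
Lemma values_check : all (fun v =>
    ~~ has (fun s => below_parity (support_word s) v)
      [:: [::]; [:: 1; 2; 3; 4; 5]; [:: 1; 2; 3; 5; 7]]%N
  ==> (v \in nseq 6 false :: invariant_values)) (words 6).
Proof. by vm_compute. Qed.

(** The Moebius sums in [values_check] are coefficients of [Q]: the constant one,
which is 0 as Q is reduced, and two of degree 5, which are 0 by the degree bound. *)
Lemma mem_invariants Q v : tabulated Q v -> size v = 6%N -> Q != 0 -> Q \in invariants.
Proof.
case=> Q_red Q_size Qv v6 Q_neq0; have [Q_sf Q0] := reduced_squarefree Q_red.
have /implyP v_check := allP values_check v (etrans (mem_words 6 v) (introT eqP v6)).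
have even s : Q@_(squarefree_mnm 8 (support_word s)) = 0 -> ~~ below_parity (support_word s) v.
  rewrite (mcoeff_below_parity Q_sf Qv (size_support_word s)).
  by case: below_parity.
have odd_deg s : (5 <= count id (support_word s))%N -> ~~ below_parity (support_word s) v.
  move=> s_ge5; apply/even/memN_msupp_eq0/msize_mdeg_ge/(leq_trans Q_size).
  by have := mdeg_squarefree_mnm (support_word s); rewrite size_support_word => ->.
have : v \in nseq 6 false :: invariant_values.
  apply: v_check; apply/hasPn => s; rewrite !inE => /or3P[] /eqP->; last 2 first.
  - exact: odd_deg.
  - exact: odd_deg.
  apply: even.
  suff -> : squarefree_mnm 8 (support_word [::]) = 0%MM by [].
  by apply/mnmP => i; rewrite mnmE mnm0E; case: i => -[|[|[|[|[|[|[|[|//]]]]]]]].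
rewrite inE => /predU1P[v0|v_in].
  case/eqP: Q_neq0; apply: (has_values_inj Q_red _ Qv) => [|w w8]; first by rewrite /reduced msupp0.
  by rewrite meval0 v0 nth_nseq if_same.
have i_lt7 : (index v invariant_values < 7)%N by rewrite index_mem.
have [P_red _ Pv] := invariants_tabulated i_lt7; rewrite nth_index // in Pv.
by rewrite (has_values_inj Q_red P_red Qv Pv) mem_nth.
Qed.

Definition zero_orbits (v : seq bool) : seq nat :=
  [seq i <- iota 0 6 | (i != 0%N) && ~~ nth false v i].

(** * Coordinates on V8 *)

Section Coordinates.

Variables (u : 'I_3 -> V2) (u_inj : injective u) (u_nz : forall i, u i != 0).

Definition vec (w : seq bool) : V8 := \sum_(i < 8) bits w i *: (ebasis u)`_i.

Lemma vec_xor w v : vec (xor w v) = vec w + vec v.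
Proof.
rewrite -big_split; apply: eq_bigr => i _.
by rewrite /bits nth_xor F2_natr_addb scalerDl.
Qed.

Lemma vec_zero : vec zero_word = 0.
Proof.
by rewrite /vec big1 // => i _; rewrite /bits nth_nseq if_same scale0r.
Qed.

(** Three distinct nonzero vectors of GF(2)^2 are all of them.  Their coordinates
are turned into bits, which leaves 64 cases. *)
Lemma u_third_det : (u 2 = u 0 + u 1) /\ u 0 0 0 * u 1 0 1 - u 0 0 1 * u 1 0 0 = 1.
Proof.
have ne_coord (v w : V2) : v != w -> (v 0 0 != w 0 0) || (v 0 1 != w 0 1).
  apply: contraR; rewrite negb_or !negbK => /andP[/eqP e0 /eqP e1].
  apply/eqP/rowP => j; case: (unliftP 0 j) => [j'|] -> //.
  by rewrite (ord1 j') (_ : lift 0 0 = 1) //; apply: val_inj.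
have u_ne i j : i != j -> u i != u j by apply: contra_neq => /u_inj.
have := (ne_coord _ _ (u_nz 0), ne_coord _ _ (u_nz 1), ne_coord _ _ (u_nz 2)).
have := (ne_coord _ _ (u_ne 0 1 isT), ne_coord _ _ (u_ne 0 2 isT), ne_coord _ _ (u_ne 1 2 isT)).
suff eq_coord (v w : V2) : v 0 0 = w 0 0 -> v 0 1 = w 0 1 -> v = w.
  move=> ne1 ne2.
  suff [e0 e1 eD] : [/\ u 2 0 0 = u 0 0 0 + u 1 0 0, u 2 0 1 = u 0 0 1 + u 1 0 1
      & u 0 0 0 * u 1 0 1 - u 0 0 1 * u 1 0 0 = 1].
    by split=> //; apply: eq_coord; rewrite mxE.
  move: ne1 ne2; rewrite !mxE.
  rewrite [u 0 0 0]F2_natr [u 0 0 1]F2_natr [u 1 0 0]F2_natr [u 1 0 1]F2_natr.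
  rewrite [u 2 0 0]F2_natr [u 2 0 1]F2_natr.
  move: (u 0 0 0 == 1) (u 0 0 1 == 1) (u 1 0 0 == 1) (u 1 0 1 == 1).
  move: (u 2 0 0 == 1) (u 2 0 1 == 1).
  by do 6!case => //=; case=> [[? ? ?]] [[? ? ?]] //; split; apply: val_inj.
by move=> e0 e1; case: (eqVneq v w) => // /ne_coord; rewrite e0 e1 !eqxx.
Qed.

Lemma u_bits (i : 'I_3) : u i = (ubit i 0)%:R *: u 0 + (ubit i 1)%:R *: u 1.
Proof.
case: i => [[|[|[|]]]] // i_lt.
- by rewrite /= scale1r scale0r addr0; congr u; apply: val_inj.
- by rewrite /= scale1r scale0r add0r; congr u; apply: val_inj.
rewrite /= !scale1r -(u_third_det).1; congr u; exact: val_inj.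
Qed.

Lemma E_entry (i j k : 'I_3) a q :
  E u i j k a q = u i 0 (mxtens_unindex (mxtens_unindex q).1).1
     * u j 0 (mxtens_unindex (mxtens_unindex q).1).2 * u k 0 (mxtens_unindex q).2.
Proof. by rewrite !mxE !ord1. Qed.

(** Both sides are trilinear in u_i, u_j, u_k, and by [u_bits] these are combinations
of u_0 and u_1; the entries are compared as polynomials in the entries of u_0, u_1. *)
Lemma E_word (i j k : 'I_3) : E u i j k = vec (segre_word [:: i : nat; j : nat; k : nat]).
Proof.
have scaleE m (x : 'F_2) (v : 'rV_m) b r : (x *: v) b r = x * v b r by rewrite mxE.
have addE (v w : V2) r : (v + w) 0 r = v 0 r + w 0 r by rewrite mxE.
apply/matrixP => a q; rewrite /vec summxE; under eq_bigr do rewrite mxE.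
rewrite !big_ord_recl big_ord0 /bits /segre_word /=.
move: (E u) E_entry => e eE; rewrite !{}eE.
rewrite [u i]u_bits [u j]u_bits [u k]u_bits.
set q1 := (mxtens_unindex _).1; set q2 := (mxtens_unindex _).2; set q3 := (mxtens_unindex _).2.
rewrite !addE !scaleE !F2_natr_andb !mulr1.
move: (u 0 0 q1) (u 1 0 q1) (u 0 0 q2) (u 1 0 q2) (u 0 0 q3) (u 1 0 q3).
move: (ubit i 0)%:R (ubit i 1)%:R (ubit j 0)%:R (ubit j 1)%:R (ubit k 0)%:R (ubit k 1)%:R.
by move=> *; ring.
Qed.

(** Up to the determinant of (u_0, u_1), which is 1, the columns of the inverse of
the matrix with rows u_0 and u_1: the functionals dual to u_0, u_1. *)
Definition dual (a : nat) : 'cV['F_2]_2 :=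
  \col_y nth 0 (if a == 0%N then [:: u 1 0 1; - u 1 0 0] else [:: - u 0 0 1; u 0 0 0]) y.

Lemma mul_dual (v : V2) a : (v *m dual a) 0 0 =
  if a == 0%N then v 0 0 * u 1 0 1 - v 0 1 * u 1 0 0
  else v 0 1 * u 0 0 0 - v 0 0 * u 0 0 1.
Proof.
rewrite mxE !big_ord_recl big_ord0 ![dual a _ _]mxE.
rewrite (_ : lift _ _ = 1); last exact: val_inj.
move: (v 0 0) (v 0 1) (u 0 0 0) (u 0 0 1) (u 1 0 0) (u 1 0 1).
by case: eqP => _ *; rewrite /= addr0 mulrN // addrC.
Qed.

Lemma dualE (i : 'I_3) (a : nat) : (a < 2)%N -> (u i *m dual a) 0 0 = (ubit i a)%:R.
Proof.
have rowE (x y : 'F_2) (v w : V2) r : (x *: v + y *: w) 0 r = x * v 0 r + y * w 0 r.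
  by rewrite !mxE.
rewrite mul_dual [u i]u_bits !rowE; have [_] := u_third_det.
move: (u 0 0 0) (u 0 0 1) (u 1 0 0) (u 1 0 1) => a0 a1 b0 b1 det1.
case: a => [|[|//]] _ /=; rewrite -[RHS]mulr1 -det1; ring.
Qed.

Definition dual3 (l : nat) : 'M['F_2]_(2 * 2 * 2, 1 * 1 * 1) :=
  let t := nth [::] basis_triples l in
  dual (nth 0%N t 0) *t dual (nth 0%N t 1) *t dual (nth 0%N t 2).

(** Tensor products of dual functionals are dual to the tensor products of u_0 and
u_1, and they read off the coordinates of every E_ijk. *)
Lemma E_dual3 (i j k : 'I_3) (l : 'I_8) :
  ((E u i j k : V8) *m dual3 l) 0 0
    = bits (segre_word [:: i : nat; j : nat; k : nat]) l.
Proof.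
pose t := nth [::] basis_triples l.
have -> : (E u i j k : V8) *m dual3 l = (u i *m dual (nth 0%N t 0))
    *t (u j *m dual (nth 0%N t 1)) *t (u k *m dual (nth 0%N t 2)).
  by rewrite -!tensmx_mul.
rewrite mxE [X in X * _]mxE !ord1 {}/t.
by case: l => -[|[|[|[|[|[|[|[|//]]]]]]]] l_lt;
  rewrite !dualE // /bits /= !F2_natr_andb mulr1 mulrA.
Qed.

Lemma ebasis_nth (i : 'I_8) : exists a b c : 'I_3,
  (ebasis u)`_i = E u a b c
  /\ nth [::] basis_triples i = [:: a : nat; b : nat; c : nat].
Proof.
by case: i => -[|[|[|[|[|[|[|[|//]]]]]]]] i_lt; do 3!eexists; split.
Qed.

(** The pairing of the i-th basis vector with the l-th functional is [i = l]. *)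
Lemma ebasis_free : free (ebasis u).
Proof.
apply/freeP => k sum0 l.
have := congr1 (fun x : V8 => (x *m dual3 l) 0 0) sum0.
rewrite mul0mx mulmx_suml summxE [RHS]mxE (bigD1 l) //= big1 => [|i i_ne_l].
  have [a [b [c [-> def_l]]]] := ebasis_nth l.
  rewrite addr0 -scalemxAl mxE E_dual3 -def_l.
  suff -> : bits (segre_word (nth [::] basis_triples l)) l = 1 by rewrite mulr1.
  by case: (l) => -[|[|[|[|[|[|[|[|//]]]]]]]].
have [a [b [c [-> def_i]]]] := ebasis_nth i.
rewrite -scalemxAl mxE E_dual3 -def_i.
suff -> : bits (segre_word (nth [::] basis_triples i)) l = 0 by rewrite mulr0.
move: i_ne_l; clear; rewrite -val_eqE /bits.
by case: i => -[|[|[|[|[|[|[|[|//]]]]]]]] i_lt;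
  case: l => -[|[|[|[|[|[|[|[|//]]]]]]]] l_lt.
Qed.

Definition coords (x : V8) : seq bool := mkseq (fun i => coord (ebasis u) (inord i) x == 1) 8.

Lemma size_coords x : size (coords x) = 8%N.
Proof. exact: size_mkseq. Qed.

Lemma bits_coords x i : bits (coords x) i = coord (ebasis u) i x.
Proof. by rewrite /bits nth_mkseq // inord_val -F2_natr. Qed.

Lemma coordsK x : vec (coords x) = x.
Proof.
have ebasis_basis : basis_of fullv (ebasis u).
  by rewrite basisEfree ebasis_free subvf dimvf.
rewrite [RHS](coord_basis ebasis_basis (memvf x)).
by apply: eq_bigr => i _; rewrite bits_coords.
Qed.

Lemma coord_vec w i : coord (ebasis u) i (vec w) = bits w i.
Proof. exact/coord_sum_free/ebasis_free. Qed.

Lemma vecK w : size w = 8%N -> coords (vec w) = w.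
Proof.
move=> w8; apply: (@eq_from_nth _ false) => [|i]; rewrite size_coords ?w8 // => i8.
by rewrite nth_mkseq // coord_vec /bits inordK // F2_natr_eq1.
Qed.

Lemma eq_vec w v : size w = 8%N -> size v = 8%N -> (vec w == vec v) = (w == v).
Proof.
by move=> w8 v8; apply/eqP/eqP => [|->//]; rewrite -{2}(vecK w8) => ->; exact: vecK.
Qed.

Lemma evalQ_vec Q w : evalQ u Q (vec w) = Q.@[bits w].
Proof. by apply: meval_eq => i; rewrite coord_vec. Qed.

Lemma coords_eq0 x : (coords x == zero_word) = (x == 0).
Proof. by rewrite -{2}[x]coordsK -vec_zero eq_vec ?size_coords. Qed.

Lemma mem_map_vec l x : all (fun w => size w == 8%N) l ->
  (x \in map vec l) = (coords x \in l).
Proof.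
move/allP => l8; apply/mapP/idP => [[w w_l ->]|x_l]; last by exists (coords x); rewrite ?coordsK.
by rewrite vecK //; apply/eqP/l8.
Qed.

(** * The point sets in coordinates *)

(** The only scalars are 0 and 1. *)
Lemma mem_span_cons (v x : V8) Y :
  (x \in <<v :: Y>>%VS) = (x \in <<Y>>%VS) || (x + v \in <<Y>>%VS).
Proof.
rewrite span_cons; apply/memv_addP/orP => [[_ /vlineP[a ->] [y y_Y ->]]|].
  rewrite [a]F2_natr; case: (a == 1); last by left; rewrite scale0r add0r.
  by right; rewrite scale1r addrAC F2_addrr add0r.
case=> [x_Y|xv_Y]; first by exists 0; rewrite ?mem0v //; exists x; rewrite ?add0r.
exists v; first exact: memv_line.
by exists (x + v) => //; rewrite addrCA F2_addrr addr0.
Qed.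

Lemma mem_span_words l x : all (fun w => size w == 8%N) l ->
  (x \in <<map vec l>>%VS) = (coords x \in span_words l).
Proof.
elim: l x => [x _|v l IHl x /= /andP[/eqP v8 l8]].
  by rewrite span_nil memv0 inE coords_eq0.
have {}IHl y := IHl y l8; rewrite mem_span_cons !IHl.
have coords_add : coords (x + vec v) = xor (coords x) v.
  by rewrite -{1}[x]coordsK -vec_xor vecK // size_xor size_coords v8.
case: ifP => [v_s|_].
  apply/orb_idr; rewrite -!IHl => xv_Y.
  by rewrite -[x](addrK (vec v)) rpredB // IHl vecK.
rewrite mem_cat coords_add; congr (_ || _); apply/idP/mapP => [xv_s|[w w_s ->]].
  by exists (xor (coords x) v); rewrite ?xorK ?size_coords.
by rewrite xorK // v8 (size_span_words l8).
Qed.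

Lemma mem_spanset (A : {set V8}) l x : all (fun w => size w == 8%N) l ->
  (forall y, (y \in A) = (coords y \in l)) ->
  (x \in spanset A) = (coords x \in span_words l).
Proof.
move=> l8 A_l; rewrite -mem_span_words // /spanset.
suff -> : (<<enum A>> = <<map vec l>>)%VS by [].
by apply: eq_span => y; rewrite mem_enum A_l mem_map_vec.
Qed.

(** The list form of a triple given as a map from the tensor positions. *)
Definition indices (t : {ffun 'I_3 -> 'I_3}) : seq nat :=
  [:: t 0 : nat; t 1 : nat; t 2 : nat].

Lemma nth_indices t (c : 'I_3) : nth 0%N (indices t) c = t c.
Proof. by case: c => -[|[|[|//]]] c_lt /=; congr (nat_of_ord (t _)); apply: val_inj. Qed.

Lemma Et_word t : Et u t = vec (segre_word (indices t)).
Proof. exact: E_word. Qed.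

Lemma coords_Et t : coords (Et u t) = segre_word (indices t).
Proof. by rewrite Et_word vecK ?size_segre_word. Qed.

Lemma indices_triple t : indices t \in triples.
Proof.
by rewrite /indices; case: (t 0) (t 1) (t 2) => -[|[|[|//]]] ? [[|[|[|//]]] ?] [[|[|[|//]]] ?].
Qed.

Lemma triple_indices s : s \in triples -> exists t, s = indices t.
Proof.
case/allpairsP => -[i s'] [+ /allpairsP[[j k] [+ + ->]] ->].
rewrite !mem_iota /= => i3 j3 k3.
exists [ffun c : 'I_3 => inord (nth 0%N [:: i; j; k] c)].
by rewrite /indices !ffunE /= !inordK.
Qed.

Lemma Et_inj : injective (Et u).
Proof.
move=> t s /(congr1 coords); rewrite !coords_Et.
move=> /(segre_word_inj (indices_triple t) (indices_triple s)) ts.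
by apply/ffunP => c; apply: val_inj; rewrite /= -!nth_indices ts.
Qed.

(** Faces, generators and S itself are images of sets of triples. *)
Lemma mem_image_Et (A : {set {ffun 'I_3 -> 'I_3}}) (p : pred (seq nat)) x :
    (forall t, (t \in A) = p (indices t)) ->
  (x \in [set Et u t | t in A]) = (coords x \in [seq segre_word t | t <- triples & p t]).
Proof.
move=> A_p; apply/imsetP/mapP => [[t t_A ->]|[s]].
  by exists (indices t); rewrite ?coords_Et // mem_filter indices_triple -A_p t_A.
rewrite mem_filter => /andP[p_s /triple_indices[t def_s]] x_s.
exists t; first by rewrite A_p -def_s.
by rewrite Et_word -def_s -x_s coordsK.
Qed.

Lemma mem_segre x : (x \in segre u) = (coords x \in segre_words).
Proof. by rewrite (mem_image_Et _ (p := predT)) ?filter_predT // => t; rewrite inE. Qed.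

Lemma forall_ord n (p : pred nat) : [forall i : 'I_n, p i] = all p (iota 0 n).
Proof.
apply/forallP/allP => [p_n i|p_n i]; last by apply: p_n; rewrite mem_iota /=.
by rewrite mem_iota /= => i_n; apply: (p_n (Ordinal i_n)).
Qed.

Lemma mem_face_flat c k x :
  (x \in face_flat u c k) = (coords x \in span_words (face_words c k)).
Proof.
apply: mem_spanset => [|y]; first exact: size_image_words.
by apply: mem_image_Et => t; rewrite inE nth_indices.
Qed.

Lemma mem_O2 x : (x \in O2 u) = O2_word (coords x).
Proof.
rewrite !inE /O2_word coords_eq0 -mem_segre; do 2!congr (_ && _).
apply/existsP/hasP => [[c /existsP[k]]|[_ /allpairsP[[c k] [+ + ->]] x_ck]].
  rewrite mem_face_flat; exists (span_words (face_words c k)) => //.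
  by apply: allpairs_f; rewrite mem_iota /=.
rewrite !mem_iota /= => c3 k3.
by exists (Ordinal c3); apply/existsP; exists (Ordinal k3); rewrite mem_face_flat.
Qed.

Lemma mem_O3 x : (x \in O3 u) = (coords x \in O3_words).
Proof.
have all_ne (t s : {ffun 'I_3 -> 'I_3}) : [forall c, t c != s c] =
    all (fun c => nth 0 (indices t) c != nth 0 (indices s) c)%N (iota 0 3).
  by rewrite -forall_ord; apply: eq_forallb => c; rewrite !nth_indices.
rewrite inE; apply/existsP/mapP => [[t /existsP[s /andP[ts /eqP->]]]|[[t s]]].
  exists (indices t, indices s); last first.
    by rewrite !Et_word -vec_xor vecK // size_xor !size_segre_word.
  by rewrite mem_filter -all_ne ts; apply/allpairsP; exists (indices t, indices s);
    rewrite !indices_triple.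
rewrite mem_filter => /andP[ts /allpairsP[[t' s'] [t_in s_in [def_t def_s]]]] x_ts.
have [t1 def_t1] := triple_indices t_in; have [s1 def_s1] := triple_indices s_in.
exists t1; apply/existsP; exists s1; rewrite all_ne -def_t1 -def_s1 -def_t -def_s.
by rewrite -[x]coordsK x_ts vec_xor !Et_word -def_t1 -def_s1 -def_t -def_s eqxx andbT.
Qed.

Lemma mem_generator c t x :
  (x \in generator u c t) = (coords x \in generator_words c (indices t)).
Proof.
apply: mem_image_Et => s; rewrite inE -forall_ord; apply: eq_forallb => d.
by rewrite !nth_indices.
Qed.

Lemma generators_at_Et t g :
  reflect (exists c, g = generator u c t) (g \in generators_at u (Et u t)).
Proof.
apply: (iffP idP) => [|[c ->]]; last first.
  rewrite inE; apply/andP; split; first by apply/imset2P; exists c t.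
  by apply/imsetP; exists t => //; rewrite inE; apply/forallP => d; rewrite eqxx implybT.
rewrite inE => /andP[/imset2P[c t' _ _ ->] /imsetP[s]].
rewrite inE => /forallP s_t' /Et_inj def_t; exists c.
apply: (congr1 (fun A : {set {ffun 'I_3 -> 'I_3}} => [set Et u r | r in A])).
apply/setP => r; rewrite !inE def_t.
by apply: eq_forallb => d; case: (d != c) (s_t' d) => //= /eqP->.
Qed.

Lemma generator_ne t c d : c != d -> generator u c t != generator u d t.
Proof.
have /allP gen_check : all (fun s => all (fun c => all (fun d => (c != d) ==>
    has (fun w => w \notin generator_words d s) (generator_words c s))
    (iota 0 3)) (iota 0 3)) triples by vm_compute.
have := gen_check _ (indices_triple t); rewrite -forall_ord => /forallP/(_ c).
rewrite -forall_ord => /forallP/(_ d)/implyP gen_cd /gen_cd/hasP[w w_c w_d].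
have w8 : size w = 8%N := eqP (allP (size_image_words _) w w_c).
apply/eqP => eq_cd; case/negP: w_d.
by rewrite -(vecK w8) -mem_generator -eq_cd mem_generator vecK.
Qed.

(** The generators through E_t are the three lines obtained by freeing one index of
t, so the spans in the definition of the tangent become spans of lists of words.
Distinct indices give distinct generators ([generator_ne]), which lets pairs of
generators be replaced by pairs of indices. *)
Lemma mem_tangent t x :
  (x \in distinguished_tangent u (Et u t)) = (coords x \in tangent_words (indices t)).
Proof.
have size_gen c : all (fun w => size w == 8%N) (generator_words c (indices t)).
  exact: size_image_words.
have mem_cover y : (y \in cover (generators_at u (Et u t)))
    = (coords y \in flatten [seq generator_words c (indices t) | c <- iota 0 3]).
  apply/bigcupP/flatten_mapP => [[_ /generators_at_Et[c ->]]|[c c3 y_c]].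
    by rewrite mem_generator; exists (c : nat); rewrite ?mem_iota /=.
  rewrite mem_iota /= in c3; exists (generator u (Ordinal c3) t).
    by apply/generators_at_Et; exists (Ordinal c3).
  by rewrite mem_generator.
have mem_plane c d : (x \in spanset (generator u c t :|: generator u d t))
    = (coords x \in span_words (generator_words c (indices t) ++ generator_words d (indices t))).
  apply: (@mem_spanset _ (generator_words c (indices t) ++ generator_words d (indices t))).
    by rewrite all_cat; apply/andP; split; apply: size_gen.
  by move=> y; rewrite inE mem_cat; congr (_ || _); apply: mem_generator.
rewrite !inE -(inj_eq (can_inj coordsK)) coords_Et mem_filter coords_eq0 -andbA.
congr (_ || (_ && _)); rewrite [RHS]andbC; congr (_ && _).
  apply: (mem_spanset _ _ mem_cover).
  by apply/allP => w /flatten_mapP[c _]; apply: (allP (size_gen c)).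
rewrite -forall_ord; apply/forall_inP/forallP => [plane c|plane g].
  rewrite -forall_ord; apply/forallP => d; apply/implyP => c_ne_d.
  have gen_in b : generator u b t \in generators_at u (Et u t).
    by apply/generators_at_Et; exists b.
  have /forall_inP/(_ _ (gen_in d))/implyP := plane _ (gen_in c).
  by rewrite mem_plane => x_cd; apply/x_cd/generator_ne.
case/generators_at_Et => c ->; apply/forall_inP => _ /generators_at_Et[d ->].
apply/implyP => gen_ne; rewrite mem_plane.
have := plane c; rewrite -forall_ord => /forallP/(_ d)/implyP; apply.
by apply: contra_neq gen_ne => /val_inj->.
Qed.

Lemma mem_O4 x : (x \in O4 u) = O4_word (coords x).
Proof.
rewrite !inE /O4_word coords_eq0 -mem_segre has_map; do 2!congr (_ && _).
apply/existsP/hasP => [[_ /andP[/imsetP[t _ ->]]]|[_ /triple_indices[t ->]]].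
  by rewrite mem_tangent; exists (indices t); rewrite ?indices_triple.
by rewrite /= -mem_tangent => x_t; exists (Et u t); rewrite imset_f.
Qed.

Lemma orbit_coords x :
  let w := coords x in
  let i := orbit_index w in
  [/\ (i < 6)%N, (i == 0%N) = (x == 0), (i == 2%N) = O2_word w, (i == 3%N) = (w \in O3_words)
    & (i == 4%N) = O4_word w /\ (i == 5%N) = (w \in segre_words)].
Proof.
have := allP orbit_check (coords x); rewrite mem_words size_coords eqxx => /(_ isT).
by rewrite /= coords_eq0 => /and5P[-> /eqP-> /eqP-> /eqP-> /andP[/eqP-> /eqP->]].
Qed.

Lemma mem_orbits :
  [/\ forall x, (x \in O1 u) = (orbit_index (coords x) == 1%N),
      forall x, (x \in O2 u) = (orbit_index (coords x) == 2%N),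
      forall x, (x \in O3 u) = (orbit_index (coords x) == 3%N),
      forall x, (x \in O4 u) = (orbit_index (coords x) == 4%N)
    & forall x, (x \in O5 u) = (orbit_index (coords x) == 5%N)].
Proof.
have E2 x : (x \in O2 u) = (orbit_index (coords x) == 2%N).
  by rewrite mem_O2; have [] := orbit_coords x.
have E3 x : (x \in O3 u) = (orbit_index (coords x) == 3%N).
  by rewrite mem_O3; have [] := orbit_coords x.
have E4 x : (x \in O4 u) = (orbit_index (coords x) == 4%N).
  by rewrite mem_O4; have [_ _ _ _ []] := orbit_coords x.
have E5 x : (x \in O5 u) = (orbit_index (coords x) == 5%N).
  by rewrite mem_segre; have [_ _ _ _ []] := orbit_coords x.
split=> // x; rewrite /O1 in_setD !in_setU E2 E3 E4 E5 inE.
have [x_lt6 <- _ _ _] := orbit_coords x.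
by case: orbit_index x_lt6 => [|[|[|[|[|[|]]]]]].
Qed.

(** * The stabilizer of the Segre variety *)

Lemma vec_act M w : vec (act_word M w) = \sum_(i < 8) bits w i *: vec (nth [::] M i).
Proof.
have vec_foldr s (F : nat -> seq bool) :
    vec (foldr (fun i => xor (F i)) zero_word s) = \sum_(i <- s) vec (F i).
  elim: s => [|i s IHs]; first by rewrite big_nil vec_zero.
  by rewrite big_cons -IHs -vec_xor.
rewrite vec_foldr -[iota 0 8]/(index_iota 0 8) big_mkord; apply: eq_bigr => i _.
rewrite /bits; case: nth; first by rewrite scale1r.
by rewrite scale0r; apply: big1 => j _; rewrite /bits nth_nil scale0r.
Qed.

Definition act_vec M (x : V8) : V8 :=
  \sum_(i < 8) coord (ebasis u) i x *: vec (nth [::] M i).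

Fact act_vec_linear M : linear (act_vec M).
Proof.
move=> a x y; rewrite scaler_sumr -big_split; apply: eq_bigr => i _.
by rewrite linearP scalerDl scalerA.
Qed.

HB.instance Definition _ M :=
  GRing.isLinear.Build 'F_2 V8 V8 _ (act_vec M) (act_vec_linear M).

Lemma act_vec_word M w : act_vec M (vec w) = vec (act_word M w).
Proof. by rewrite vec_act; apply: eq_bigr => i _; rewrite coord_vec. Qed.

(** A move is an involution on words, hence invertible as a linear map, and it
permutes S. *)
Lemma move_stab M : M \in moves ->
  exists2 A, A \in segre_stab u & forall w, vec w *m GLval A = vec (act_word M w).
Proof.
move=> /(allP moves_check)/andP[/allP actK /allP act_segre].
pose A := lin1_mx (act_vec M).
have A_vec w : vec w *m A = vec (act_word M w) by rewrite mul_rV_lin1 /= act_vec_word.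
have AA : A *m A = 1%:M.
  apply/row_matrixP => i; rewrite !rowE mulmxA mulmx1 -[delta_mx 0 i]coordsK !A_vec.
  by congr vec; apply/eqP/actK; rewrite mem_words size_coords.
have [uA _] := mulmx1_unit AA.
exists (FinRing.unit _ uA : {'GL_(2 * 2 * 2)['F_2]}) => //.
have A_inj : injective (fun x : V8 => x *m A).
  by move=> x y /(congr1 (mulmx^~ A)); rewrite -!mulmxA AA !mulmx1.
rewrite inE -[GLval _]/A eqEcard (card_imset _ A_inj) leqnn andbT.
apply/subsetP => _ /imsetP[x x_S ->].
have /act_segre Mx_S : coords x \in segre_words by rewrite -mem_segre.
have Mx8 : size (act_word M (coords x)) = 8%N.
  by case/mapP: Mx_S => t _ ->; apply: size_segre_word.
by rewrite -[x]coordsK A_vec mem_segre (vecK Mx8).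
Qed.

(** By [move_stab] such a function is constant along the exploration of [reach]. *)
Lemma invariant_rep (T : eqType) (f : V8 -> T) :
    (forall A, A \in segre_stab u -> forall x : V8, f (x *m GLval A) = f x) ->
  forall x, f x = f (vec (nth [::] orbit_reps (orbit_index (coords x)))).
Proof.
move=> f_inv x; set i := orbit_index _.
have i_lt6 : (i < size orbits)%N by have [] := orbit_coords x.
have x_i : coords x \in nth [::] orbits i.
  by apply: (nth_find _ (a := fun l => coords x \in l)); rewrite has_find.
pose P w := f (vec w) == f (vec (nth [::] orbit_reps i)).
suff /allP/(_ _ x_i) : all P (nth [::] orbits i) by rewrite /P coordsK => /eqP.
rewrite (nth_map [::]); last by rewrite size_map in i_lt6.
apply: all_reach; rewrite /P // => M v /move_stab[A A_S A_vec] /eqP<-.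
by rewrite -A_vec f_inv.
Qed.

(** The invariant that separates the orbits. *)
Definition segre_triples (x : V8) : nat :=
  (\sum_(p in segre u) \sum_(q in segre u) ((x + p + q)%R \in segre u))%N.

Lemma mem_segre_stab A : A \in segre_stab u ->
  forall x : V8, (x *m GLval A \in segre u) = (x \in segre u).
Proof.
rewrite inE => /eqP A_S x; rewrite -{1}A_S.
apply: (mem_imset (f := fun y : V8 => y *m GLval A)).
exact: can_inj (mulmxK (GL_unitmx A)).
Qed.

Lemma segre_triples_stab A : A \in segre_stab u ->
  forall x : V8, segre_triples (x *m GLval A) = segre_triples x.
Proof.
move=> A_S x; have A_inj : injective (fun x : V8 => x *m GLval A).
  exact: can_inj (mulmxK (GL_unitmx A)).
rewrite /segre_triples (reindex_inj A_inj) /=.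
under eq_bigl do rewrite mem_segre_stab //.
apply: eq_bigr => p _; rewrite (reindex_inj A_inj) /=.
under eq_bigl do rewrite mem_segre_stab //.
by apply: eq_bigr => q _; rewrite -!mulmxDl mem_segre_stab.
Qed.

Lemma sum_segre (F : V8 -> nat) :
  (\sum_(p in segre u) F p)%N = sumn [seq F (vec w) | w <- segre_words].
Proof.
have segre8 : all (fun w => size w == 8%N) segre_words by vm_compute.
rewrite sumnE big_map -(big_map vec predT) -big_enum; apply: perm_big.
apply: uniq_perm; first exact: enum_uniq.
  rewrite map_inj_in_uniq; first by vm_compute.
  by move=> w v /(allP segre8)/eqP w8 /(allP segre8)/eqP v8 /eqP; rewrite eq_vec // => /eqP.
by move=> x; rewrite mem_enum mem_map_vec // mem_segre.
Qed.

Lemma segre_triples_vec w : size w = 8%N -> segre_triples (vec w) = triple_count w.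
Proof.
have segre8 : {in segre_words, forall w, size w = 8%N}.
  by move=> _ /mapP[t _ ->]; apply: size_segre_word.
move=> w8; rewrite /segre_triples sum_segre; congr sumn; apply/eq_in_map => p /segre8 p8.
rewrite sum_segre; congr sumn; apply/eq_in_map => q /segre8 q8.
by rewrite -!vec_xor mem_segre vecK // !size_xor w8 p8 q8.
Qed.

(** The number [segre_triples] is invariant and takes distinct values at the six
representatives. *)
Lemma orbit_index_stab A : A \in segre_stab u ->
  forall x : V8, orbit_index (coords (x *m GLval A)) = orbit_index (coords x).
Proof.
have /andP[count_uniq reps8] := triple_count_check.
move=> A_S x; have := segre_triples_stab A_S x.
have count_rep y : segre_triples y
    = nth 0%N (map triple_count orbit_reps) (orbit_index (coords y)).
  have [y_lt6 _ _ _ _] := orbit_coords y.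
  rewrite (@nth_map _ [::] _ _ _ _ orbit_reps y_lt6) (invariant_rep segre_triples_stab).
  exact/segre_triples_vec/eqP/(allP reps8)/mem_nth/y_lt6.
have [x_lt6 _ _ _ _] := orbit_coords x.
have [xA_lt6 _ _ _ _] := orbit_coords (x *m GLval A).
rewrite !count_rep => /eqP.
by rewrite (@nth_uniq _ _ (map triple_count orbit_reps) _ _ xA_lt6 x_lt6 count_uniq) => /eqP.
Qed.

(** * Invariant polynomials *)

Lemma evalQ_values Q v x : has_values Q v ->
  evalQ u Q x = (nth false v (orbit_index (coords x)))%:R.
Proof. by move=> Qv; rewrite -[in LHS](coordsK x) evalQ_vec Qv ?size_coords. Qed.

Lemma values_stab_invariant Q v : has_values Q v -> stab_invariant u Q.
Proof.
by move=> Qv A A_S x; rewrite !(evalQ_values _ Qv) (orbit_index_stab A_S).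
Qed.

Lemma stab_invariant_values Q : stab_invariant u Q ->
  has_values Q (rep_values Q).
Proof.
move=> Q_inv w w8; rewrite -(evalQ_vec Q w) (invariant_rep Q_inv) vecK //.
have [w_lt6 _ _ _ _] := orbit_coords (vec w); rewrite vecK // in w_lt6.
by rewrite (@nth_map _ [::] _ _ _ _ orbit_reps w_lt6) -F2_natr evalQ_vec.
Qed.

Lemma card_coords (A : {set V8}) (p : pred (seq bool)) :
  (forall x, (x \in A) = p (coords x)) -> #|A| = count p (words 8).
Proof.
move=> A_p; have f8 : all (fun w => size w == 8%N) (filter p (words 8)).
  by apply/allP => w; rewrite mem_filter mem_words => /andP[].
rewrite cardE -size_filter -(size_map vec); apply: perm_size.
apply: uniq_perm => [||x]; first exact: enum_uniq.
  rewrite map_inj_in_uniq ?filter_uniq ?uniq_words //.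
  by move=> w v /(allP f8)/eqP w8 /(allP f8)/eqP v8 /eqP; rewrite eq_vec // => /eqP.
by rewrite mem_enum mem_map_vec // mem_filter mem_words size_coords eqxx andbT A_p.
Qed.

Lemma zero_set_values Q v x : has_values Q v ->
  (x \in zero_set u Q) = (orbit_index (coords x) \in zero_orbits v).
Proof.
move=> Qv; rewrite inE inE (evalQ_values _ Qv).
have [x_lt6 <- _ _ _] := orbit_coords x.
rewrite mem_filter mem_iota x_lt6 /= andbT; congr (_ && _).
by case: nth.
Qed.

Lemma values_on_orbits_table Q v : has_values Q v ->
  values_on_orbits u Q (nth false v 1)%:R (nth false v 2)%:R (nth false v 3)%:R
    (nth false v 4)%:R (nth false v 5)%:R.
Proof.
move=> Qv; have [E1 E2 E3 E4 E5] := mem_orbits.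
by split=> x; rewrite ?E1 ?E2 ?E3 ?E4 ?E5 (evalQ_values _ Qv) => /eqP->.
Qed.

Lemma zero_set_card Q v : has_values Q v -> #|zero_set u Q| =
  count (fun w => orbit_index w \in zero_orbits v) (words 8).
Proof.
move=> Qv; apply: (@card_coords _ (fun w => orbit_index w \in _)) => x.
exact: zero_set_values.
Qed.

(** The list [s] holds the variables of a monomial of degree [d] that occurs in [Q]. *)
Lemma invariant_row Q v s d (A : {set V8}) n :
    tabulated Q v -> (msize Q <= d.+1)%N ->
    below_parity (support_word s) v && (count id (support_word s) == d) ->
    (forall x, (x \in A) = (orbit_index (coords x) \in zero_orbits v)) ->
    count (fun w => orbit_index w \in zero_orbits v) (words 8) == n ->
  [/\ deg Q = d,
      values_on_orbits u Q (nth false v 1)%:R (nth false v 2)%:R (nth false v 3)%:R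
        (nth false v 4)%:R (nth false v 5)%:R,
      zero_set u Q = A & #|zero_set u Q| = n].
Proof.
move=> Qv Q_d s_d A_v /eqP<-; have [_ _ v_val] := Qv; split.
- exact: deg_tabulated Qv Q_d s_d.
- exact: values_on_orbits_table.
- by apply/setP => x; rewrite (zero_set_values _ v_val) A_v.
exact: zero_set_card.
Qed.

Lemma invariant_iff Q :
  [/\ reduced Q, Q != 0, (deg Q <= 4)%N & stab_invariant u Q] <-> Q \in invariants.
Proof.
split=> [[Q_red Q_neq0 Q_deg Q_inv]|Q_in].
  have Q_tab : tabulated Q (rep_values Q).
    split; [by []| |exact: stab_invariant_values].
    by move: Q_deg; rewrite /deg; case: (msize Q).
  exact: mem_invariants Q_tab (size_map _ _) Q_neq0.
have i_lt7 : (index Q invariants < 7)%N by rewrite index_mem.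
have := invariants_tabulated i_lt7; rewrite nth_index // => -[Q_red Q_size Qv].
split=> //; last exact: values_stab_invariant Qv.
  exact: invariants_neq0.
by rewrite /deg; case: (msize Q) Q_size.
Qed.

End Coordinates.

Theorem theorem17 (u : 'I_3 -> V2) (u_inj : injective u)
    (u_nz : forall i, u i != 0) :
  let L := [:: Q2; Q4; Q4'; Q4 + Q4'; Q2 + Q4; Q2 + Q4'; Q2 + Q4 + Q4'] in
  [/\ size L = 7%N /\ uniq L,
      forall Q : {mpoly 'F_2[8]},
        [/\ reduced Q, Q != 0, (deg Q <= 4)%N & stab_invariant u Q] <-> Q \in L
    & [/\ [/\ deg Q2 = 2%N, values_on_orbits u Q2 1 0 1 0 0,
              zero_set u Q2 = O2 u :|: O4 u :|: O5 u
            & #|zero_set u Q2| = 135%N],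
          [/\ deg Q4 = 4%N, values_on_orbits u Q4 1 0 1 1 0,
              zero_set u Q4 = O2 u :|: O5 u
            & #|zero_set u Q4| = 81%N],
          [/\ deg Q4' = 4%N, values_on_orbits u Q4' 1 1 0 0 0,
              zero_set u Q4' = O3 u :|: O4 u :|: O5 u
            & #|zero_set u Q4'| = 189%N],
          [/\ deg (Q4 + Q4') = 4%N, values_on_orbits u (Q4 + Q4') 0 1 1 1 0,
              zero_set u (Q4 + Q4') = O1 u :|: O5 u
            & #|zero_set u (Q4 + Q4')| = 39%N]
        & [/\ [/\ deg (Q2 + Q4) = 4%N, values_on_orbits u (Q2 + Q4) 0 0 0 1 0,
                  zero_set u (Q2 + Q4) = O1 u :|: O2 u :|: O3 u :|: O5 u
                & #|zero_set u (Q2 + Q4)| = 201%N],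
              [/\ deg (Q2 + Q4') = 4%N, values_on_orbits u (Q2 + Q4') 0 1 1 0 0,
                  zero_set u (Q2 + Q4') = O1 u :|: O4 u :|: O5 u
                & #|zero_set u (Q2 + Q4')| = 93%N]
            & [/\ deg (Q2 + Q4 + Q4') = 4%N,
                  values_on_orbits u (Q2 + Q4 + Q4') 1 1 0 1 0,
                  zero_set u (Q2 + Q4 + Q4') = O3 u :|: O5 u
                & #|zero_set u (Q2 + Q4 + Q4')| = 135%N]]]].
Proof.
have [E1 E2 E3 E4 E5] := mem_orbits u_inj u_nz.
have tab i (i_lt7 : (i < 7)%N) := invariants_tabulated i_lt7.
have size5 i (i_lt7 : (i < 7)%N) : (msize invariants`_i <= 5)%N by case: (tab i i_lt7).
split; first by split; last exact: uniq_invariants.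
  exact: invariant_iff.
(* The monomials 18, 1357 and 1278 witness the degrees. *)
split; last split.
- apply: (invariant_row u_inj u_nz (tab 0%N isT) (s := [:: 1; 8]%N)) => [||x|].
  + exact: msize_monsum.
  + by vm_compute.
  + by rewrite !in_setU E2 E4 E5; case: orbit_index => [|[|[|[|[|[|]]]]]].
  by vm_compute.
- apply: (invariant_row u_inj u_nz (tab 1%N isT) (s := [:: 1; 3; 5; 7]%N)) => [||x|].
  + exact: (size5 1%N).
  + by vm_compute.
  + by rewrite !in_setU E2 E5; case: orbit_index => [|[|[|[|[|[|]]]]]].
  by vm_compute.
- apply: (invariant_row u_inj u_nz (tab 2%N isT) (s := [:: 1; 2; 7; 8]%N)) => [||x|].
  + exact: (size5 2%N).
  + by vm_compute.
  + by rewrite !in_setU E3 E4 E5; case: orbit_index => [|[|[|[|[|[|]]]]]].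
  by vm_compute.
- apply: (invariant_row u_inj u_nz (tab 3%N isT) (s := [:: 1; 3; 5; 7]%N)) => [||x|].
  + exact: (size5 3%N).
  + by vm_compute.
  + by rewrite !in_setU E1 E5; case: orbit_index => [|[|[|[|[|[|]]]]]].
  by vm_compute.
- apply: (invariant_row u_inj u_nz (tab 4%N isT) (s := [:: 1; 3; 5; 7]%N)) => [||x|].
  + exact: (size5 4%N).
  + by vm_compute.
  + by rewrite !in_setU E1 E2 E3 E5; case: orbit_index => [|[|[|[|[|[|]]]]]].
  by vm_compute.
- apply: (invariant_row u_inj u_nz (tab 5%N isT) (s := [:: 1; 2; 7; 8]%N)) => [||x|].
  + exact: (size5 5%N).
  + by vm_compute.
  + by rewrite !in_setU E1 E4 E5; case: orbit_index => [|[|[|[|[|[|]]]]]].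
  by vm_compute.
- apply: (invariant_row u_inj u_nz (tab 6%N isT) (s := [:: 1; 3; 5; 7]%N)) => [||x|].
  + exact: (size5 6%N).
  + by vm_compute.
  + by rewrite !in_setU E3 E5; case: orbit_index => [|[|[|[|[|[|]]]]]].
  by vm_compute.
Qed.
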